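(* Let $m,n\ge1$, let $\Phi^1\le\Gamma^1$, $\Phi^2\le\Gamma^2$ be integer-valued $m\times n$ matrices (entries of $\Phi^1,\Phi^2$ may be $-\infty$, of $\Gamma^1,\Gamma^2$ may be $+\infty$), let $f\le g$ be integer-valued functions on $S_{m,n}$ ($f$ may take $-\infty$, $g$ may take $+\infty$), and let $\alpha\le\beta$ be in $\mathbb{Z}\cup\{\pm\infty\}$. Let $D$ be the digraph with vertices $v^1_{i,j},v^2_{i,j}$ for $(i,j)\in S_{m,n}$ and two further vertices $v^1_0,v^2_0$, and with arcs: $a^1_{i,j}=v^1_{i,j+1}v^1_{i,j}$ for $i\in[m]$, $j\in[n-1]$; $a^1_{i,n}=v^1_0v^1_{i,n}$ for $i\in[m]$; $a^2_{i,j}=v^2_{i,j}v^2_{i+1,j}$ for $i\in[m-1]$, $j\in[n]$; $a^2_{m,j}=v^2_{m,j}v^2_0$ for $j\in[n]$; $a_{i,j}=v^1_{i,j}v^2_{i,j}$ for $(i,j)\in S_{m,n}$; and $a_0=v^2_0v^1_0$. Define bounds $l,u$ on the arcs by $l(a^1_{i,j})=\Phi^1(i,j)$, $u(a^1_{i,j})=\Gamma^1(i,j)$, $l(a^2_{i,j})=\Phi^2(i,j)$, $u(a^2_{i,j})=\Gamma^2(i,j)$, $l(a_{i,j})=f(i,j)$, $u(a_{i,j})=g(i,j)$, $l(a_0)=\alpha$, $u(a_0)=\beta$. (A) If $z$ is an integer-valued circulation in $D$ with $l\le z\le u$, then the $m\times n$ matrix $M_z$ with $M_z(i,j):=z(a_{i,j})$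 is a prefix-bounded matrix (with respect to $\Phi^1,\Gamma^1,\Phi^2,\Gamma^2$) whose entries lie between $f$ and $g$ and whose total entry-sum lies between $\alpha$ and $\beta$. (B) Conversely, if $M$ is a prefix-bounded matrix whose entries lie between $f$ and $g$ and whose total entry-sum lies between $\alpha$ and $\beta$, then the function $z_M$ defined by $z_M(a^1_{i,j}):=M(i,1)+\dots+M(i,j)$, $z_M(a^2_{i,j}):=M(1,j)+\dots+M(i,j)$, $z_M(a_{i,j}):=M(i,j)$, $z_M(a_0):=\sum_{(i,j)\in S_{m,n}}M(i,j)$ is an integer-valued circulation in $D$ with $l\le z_M\le u$.
   Context: $S_{m,n}=[m]\times[n]$; matrices are functions on $S_{m,n}$ and $\tilde x(Z)=\sum_{s\in Z}x(s)$. $P^1_{i,j}=\{(i,1),\dots,(i,j)\}$, $P^2_{i,j}=\{(1,j),\dots,(i,j)\}$. A prefix-bounded matrix with respect to $\Phi^1,\Gamma^1,\Phi^2,\Gamma^2$ is an integer-valued $m\times n$ matrix $x$ with $\Phi^1(i,j)\le\tilde x(P^1_{i,j})\le\Gamma^1(i,j)$ and $\Phi^2(i,j)\le\tilde x(P^2_{i,j})\le\Gamma^2(i,j)$ for all $(i,j)$. A circulation in a digraph is a real function on the arcs such that at every vertex the total value of entering arcs equals the total value of leaving arcs. *)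

(* Defs.v *)
From HB Require Import structures.
From mathcomp Require Import all_boot all_order all_algebra.
From mathcomp Require Import constructive_ereal reals.

Set Implicit Arguments.
Unset Strict Implicit.
Unset Printing Implicit Defensive.

Import Order.TTheory GRing.Theory Num.Theory.
Local Open Scope ring_scope.

Record digraph := Digraph {
  dvertex : finType;
  darc : finType;
  dtail : darc -> dvertex;
  dhead : darc -> dvertex
}.

Definition circulation (R : realType) (D : digraph) (z : darc D -> R) : Prop :=
  forall v : dvertex D, \sum_(a | dhead a == v) z a = \sum_(a | dtail a == v) z a.

Definition integer_valued (R : realType) (T : Type) (z : T -> R) : Prop :=
  forall t, z t \is a Num.int.

(* Rows and columns are numbered from 0: the pair (i, j) of the mathematical
   text, 1 <= i <= m and 1 <= j <= n, is (i - 1, j - 1) : 'I_m * 'I_n. *)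

Definition integer_matrix (R : realType) (m n : nat) (x : 'M[R]_(m, n)) : Prop :=
  forall i j, x i j \is a Num.int.

Definition ext_integer (R : realType) (x : \bar R) : Prop :=
  x = -oo%E \/ x = +oo%E \/ exists k : int, x = (k%:~R)%:E.

Definition lower_bound_matrix (R : realType) (m n : nat)
    (x : 'M[\bar R]_(m, n)) : Prop :=
  forall i j, ext_integer (x i j) /\ x i j <> +oo%E.

Definition upper_bound_matrix (R : realType) (m n : nat)
    (x : 'M[\bar R]_(m, n)) : Prop :=
  forall i j, ext_integer (x i j) /\ x i j <> -oo%E.

Definition le_matrix (R : realType) (m n : nat) (x y : 'M[\bar R]_(m, n)) : Prop :=
  forall i j, (x i j <= y i j)%E.

Definition entries_between (R : realType) (m n : nat) (f g : 'M[\bar R]_(m, n))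
    (x : 'M[R]_(m, n)) : Prop :=
  forall i j, (f i j <= (x i j)%:E <= g i j)%E.

Definition set_sum (R : realType) (m n : nat) (x : 'M[R]_(m, n))
    (Z : {set 'I_m * 'I_n}) : R :=
  \sum_(s in Z) x s.1 s.2.

Definition row_prefix (m n : nat) (i : 'I_m) (j : 'I_n) : {set 'I_m * 'I_n} :=
  [set s : 'I_m * 'I_n | (s.1 == i) && (s.2 <= j)%N].

Definition col_prefix (m n : nat) (i : 'I_m) (j : 'I_n) : {set 'I_m * 'I_n} :=
  [set s : 'I_m * 'I_n | (s.1 <= i)%N && (s.2 == j)].

Definition prefix_bounded (R : realType) (m n : nat)
    (Phi1 Gamma1 Phi2 Gamma2 : 'M[\bar R]_(m, n)) (x : 'M[R]_(m, n)) : Prop :=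
  integer_matrix x /\
  forall i j,
    (Phi1 i j <= (set_sum x (row_prefix i j))%:E <= Gamma1 i j)%E /\
    (Phi2 i j <= (set_sum x (col_prefix i j))%:E <= Gamma2 i j)%E.

Inductive pm_vertex (m n : nat) :=
  | V1 of 'I_m & 'I_n
  | V2 of 'I_m & 'I_n
  | V10
  | V20.
Arguments V1 {m n} _ _.
Arguments V2 {m n} _ _.
Arguments V10 {m n}.
Arguments V20 {m n}.

Inductive pm_arc (m n : nat) :=
  | A1 of 'I_m & 'I_n
  | A2 of 'I_m & 'I_n
  | Aij of 'I_m & 'I_n
  | A0.
Arguments A1 {m n} _ _.
Arguments A2 {m n} _ _.
Arguments Aij {m n} _ _.
Arguments A0 {m n}.

Section FiniteTypes.
Variables m n : nat.
Let S := ('I_m * 'I_n)%type.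

Definition pm_vertex_code (v : pm_vertex m n) : S + S + bool :=
  match v with
  | V1 i j => inl (inl (i, j))
  | V2 i j => inl (inr (i, j))
  | V10 => inr true
  | V20 => inr false
  end.
Definition pm_vertex_decode (c : S + S + bool) : pm_vertex m n :=
  match c with
  | inl (inl s) => V1 s.1 s.2
  | inl (inr s) => V2 s.1 s.2
  | inr b => if b then V10 else V20
  end.
Lemma pm_vertex_codeK : cancel pm_vertex_code pm_vertex_decode.
Proof. by case. Qed.
HB.instance Definition _ := Finite.copy (pm_vertex m n) (can_type pm_vertex_codeK).

Definition pm_arc_code (a : pm_arc m n) : S + S + S + unit :=
  match a with
  | A1 i j => inl (inl (inl (i, j)))
  | A2 i j => inl (inl (inr (i, j)))
  | Aij i j => inl (inr (i, j))
  | A0 => inr tt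
  end.
Definition pm_arc_decode (c : S + S + S + unit) : pm_arc m n :=
  match c with
  | inl (inl (inl s)) => A1 s.1 s.2
  | inl (inl (inr s)) => A2 s.1 s.2
  | inl (inr s) => Aij s.1 s.2
  | inr _ => A0
  end.
Lemma pm_arc_codeK : cancel pm_arc_code pm_arc_decode.
Proof. by case. Qed.
HB.instance Definition _ := Finite.copy (pm_arc m n) (can_type pm_arc_codeK).

End FiniteTypes.

(* [insub k : option 'I_p] is [None] exactly when [p <= k], so the [None]
   branches below are those of the last column and of the last row. *)
Definition pm_tail (m n : nat) (a : pm_arc m n) : pm_vertex m n :=
  match a with
  | A1 i j => if (insub j.+1 : option 'I_n) is Some j' then V1 i j' else V10
  | A2 i j => V2 i j
  | Aij i j => V1 i j
  | A0 => V20
  end.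

Definition pm_head (m n : nat) (a : pm_arc m n) : pm_vertex m n :=
  match a with
  | A1 i j => V1 i j
  | A2 i j => if (insub i.+1 : option 'I_m) is Some i' then V2 i' j else V20
  | Aij i j => V2 i j
  | A0 => V10
  end.

Definition pm_digraph (m n : nat) : digraph :=
  Digraph (@pm_tail m n) (@pm_head m n).

Definition arc_bound (R : realType) (m n : nat) (X1 X2 X : 'M[\bar R]_(m, n))
    (c : \bar R) (a : darc (pm_digraph m n)) : \bar R :=
  match a with
  | A1 i j => X1 i j
  | A2 i j => X2 i j
  | Aij i j => X i j
  | A0 => c
  end.

Definition matrix_of_circ (R : realType) (m n : nat)
    (z : darc (pm_digraph m n) -> R) : 'M[R]_(m, n) :=
  \matrix_(i < m, j < n) z (Aij i j).

Definition circ_of_matrix (R : realType) (m n : nat) (M : 'M[R]_(m, n))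
    (a : darc (pm_digraph m n)) : R :=
  match a with
  | A1 i j => \sum_(k < n | (k <= j)%N) M i k
  | A2 i j => \sum_(k < m | (k <= i)%N) M k j
  | Aij i j => M i j
  | A0 => \sum_(s : 'I_m * 'I_n) M s.1 s.2
  end.

(* Main.v *)
(** Conservation at [v^1_{i,j}] reads z(a^1_{i,j}) = z(a_{i,j}) + z(a^1_{i,j-1}),
    so along each row the arc values are the partial sums of z(a_{i,j}); the
    same holds along columns at [v^2_{i,j}]. Conservation at [v^1_0] makes
    z(a_0) the total sum. Hence the circulations of D are exactly the functions
    z_M, with M = M_z, and all bounds translate literally. *)
Require Import Defs.
From HB Require Import structures.
From mathcomp Require Import all_boot all_order all_algebra.
From mathcomp Require Import constructive_ereal reals.

Set Implicit Arguments.
Unset Strict Implicit.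
Unset Printing Implicit Defensive.

Import Order.TTheory GRing.Theory Num.Theory.
Local Open Scope ring_scope.

(** * Sums over arcs and over pairs of indices *)

Lemma pm_arc_decodeK (m n : nat) : cancel (@pm_arc_decode m n) (@pm_arc_code m n).
Proof. by case=> [[[[]|[]]|[]]|[]]. Qed.

(** Decoding is a bijection from a sum type, over which a big sum splits by summand. Each vertex
    balance below is computed from this split. *)
Lemma big_pm_arc (R : nmodType) (m n : nat) (P : pred (pm_arc m n))
    (z : pm_arc m n -> R) :
  \sum_(a | P a) z a =
    \sum_(s | P (A1 s.1 s.2)) z (A1 s.1 s.2) +
    \sum_(s | P (A2 s.1 s.2)) z (A2 s.1 s.2) +
    \sum_(s | P (Aij s.1 s.2)) z (Aij s.1 s.2) +
    (if P A0 then z A0 else 0).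
Proof.
rewrite (reindex (@pm_arc_decode m n)) /=; last first.
  by exists (@pm_arc_code m n) => a _; rewrite ?pm_arc_codeK ?pm_arc_decodeK.
rewrite !big_sumType /=; congr (_ + _).
by rewrite big_mkcond (big_pred1 tt) //; case.
Qed.

(** On codes, the test simplifies to a comparison of tags and indices. *)
Lemma pm_vertex_eqE (m n : nat) (v w : pm_vertex m n) :
  (v == w) = (pm_vertex_code v == pm_vertex_code w).
Proof. by rewrite (inj_eq (can_inj (@pm_vertex_codeK m n))). Qed.

Section BigPair.
Variables (R : nmodType) (I J : finType) (F : I -> J -> R).

Lemma big_pair_row (i : I) (Q : pred J) :
  \sum_(s : I * J | (s.1 == i) && Q s.2) F s.1 s.2 = \sum_(j | Q j) F i j.
Proof. by rewrite -(pair_big (pred1 i) Q F) big_pred1_eq. Qed.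

Lemma big_pair_col (P : pred I) (j : J) :
  \sum_(s : I * J | P s.1 && (s.2 == j)) F s.1 s.2 = \sum_(i | P i) F i j.
Proof.
rewrite -(pair_big P (pred1 j) F); apply: eq_bigr => i _.
by rewrite big_pred1_eq.
Qed.

End BigPair.

(** * Prefix sums and the recurrence that characterises them *)

Section PrefixSums.
Variables (R : nmodType) (n : nat) (F : 'I_n -> R).

(* The sum over [k.+1 == j] is the predecessor term, and is empty at [j = 0]. *)
Lemma prefix_sum_rec (j : 'I_n) :
  \sum_(k < n | (k <= j)%N) F k =
    F j + \sum_(k < n | k.+1 == j) \sum_(l < n | (l <= k)%N) F l.
Proof.
rewrite (bigD1 j) //=; congr (_ + _).
have [j0|j_gt0] := posnP j.
  rewrite !big_pred0 // => k; first by rewrite j0.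
  by rewrite -val_eqE /= andbC -ltn_neqAle j0.
have j1_lt : (j.-1 < n)%N by rewrite (leq_ltn_trans (leq_pred j)).
(* The only [k] with [k.+1 == j] is [j.-1], and the indices up to [j.-1] are those strictly below
   [j]. *)
rewrite [RHS](big_pred1 (Ordinal j1_lt)) => [|k]; last first.
  by rewrite /= -val_eqE -[RHS]eqSS /= prednK.
apply: eq_bigl => k.
by rewrite -val_eqE /= andbC -ltn_neqAle -[RHS]ltnS prednK.
Qed.

(** By induction on the index, the recurrence of [prefix_sum_rec] has a single solution; this is how
    conservation forces the arc values. *)
Lemma prefix_sum_unique (G : 'I_n -> R) :
  (forall j, G j = F j + \sum_(k < n | k.+1 == j) G k) ->
  forall j, G j = \sum_(k < n | (k <= j)%N) F k.
Proof.
move=> G_rec [j]; elim: j => [|j IHj] lt_jn; rewrite G_rec prefix_sum_rec.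
  by congr (_ + _); rewrite !big_pred0.
congr (_ + _); apply: eq_bigr => -[k lt_kn] /=; rewrite eqSS => /eqP eq_kj.
(* The induction hypothesis covers every proof of the bound, hence any ordinal of value [j]. *)
by subst k; apply: IHj.
Qed.

(** The condition selects the last index, whose prefix is everything; for [n = 0] both sums are
    empty. *)
Lemma prefix_sum_last :
  \sum_(j < n | j.+1 == n) \sum_(k < n | (k <= j)%N) F k = \sum_k F k.
Proof.
have [n0|n_gt0] := posnP n.
  by rewrite !big_pred0 // => k; have := ltn_ord k; rewrite [X in (_ < X)%N]n0.
have n1_lt : (n.-1 < n)%N by rewrite prednK.
rewrite (big_pred1 (Ordinal n1_lt)) => [|k]; last first.
  by rewrite /= -val_eqE -[RHS]eqSS /= prednK.
by apply: eq_bigl => k /=; rewrite -ltnS prednK ?ltn_ord.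
Qed.

End PrefixSums.

(** * Incidence of arcs and vertices *)

Section ArcEnds.
Variables m n : nat.
Implicit Types (i k : 'I_m) (j l : 'I_n).

Lemma pm_tail_A1_V1 k l i j :
  (pm_tail (A1 k l) == V1 i j) = (k == i) && (l.+1 == j :> nat).
Proof.
rewrite pm_vertex_eqE /=; case: insubP => [l' _ /= <-|] //=.
(* In the last column the tail is [V10], and [l.+1] exceeds every column index [j]. *)
rewrite -leqNgt => le_nl; apply/esym/andP => -[_ /eqP eq_lj].
by rewrite eq_lj leqNgt ltn_ord in le_nl.
Qed.

Lemma pm_tail_A1_V2 k l i j : (pm_tail (A1 k l) == V2 i j) = false.
Proof. by rewrite pm_vertex_eqE /=; case: insubP. Qed.

Lemma pm_tail_A1_V10 k l : (pm_tail (A1 k l) == V10) = (l.+1 == n).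
Proof.
rewrite pm_vertex_eqE /=; case: insubP => [l' lt_ln _|] /=.
  by rewrite ltn_eqF.
by rewrite -leqNgt eqn_leq ltn_ord => ->.
Qed.

Lemma pm_tail_A1_V20 k l : (pm_tail (A1 k l) == V20) = false.
Proof. by rewrite pm_vertex_eqE /=; case: insubP. Qed.

Lemma pm_head_A2_V1 k l i j : (pm_head (A2 k l) == V1 i j) = false.
Proof. by rewrite pm_vertex_eqE /=; case: insubP. Qed.

Lemma pm_head_A2_V2 k l i j :
  (pm_head (A2 k l) == V2 i j) = (k.+1 == i :> nat) && (l == j).
Proof.
rewrite pm_vertex_eqE /=; case: insubP => [k' _ /= <-|] //=.
rewrite -leqNgt => le_mk; apply/esym/andP => -[/eqP eq_ki _].
by rewrite eq_ki leqNgt ltn_ord in le_mk.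
Qed.

Lemma pm_head_A2_V10 k l : (pm_head (A2 k l) == V10) = false.
Proof. by rewrite pm_vertex_eqE /=; case: insubP. Qed.

Lemma pm_head_A2_V20 k l : (pm_head (A2 k l) == V20) = (k.+1 == m).
Proof.
rewrite pm_vertex_eqE /=; case: insubP => [k' lt_km _|] /=.
  by rewrite ltn_eqF.
by rewrite -leqNgt eqn_leq ltn_ord => ->.
Qed.

End ArcEnds.

(** * Inflow and outflow at each vertex *)

Section Balance.
Variables (R : realType) (m n : nat) (z : darc (pm_digraph m n) -> R).
Implicit Types (i : 'I_m) (j : 'I_n).
Local Notation D := (pm_digraph m n).

Lemma inflow_V1 i j : \sum_(a : darc D | dhead a == V1 i j) z a = z (A1 i j).
Proof.
rewrite big_pm_arc /= [X in _ + X + _ + _]big_pred0; last first.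
  by move=> s; exact: pm_head_A2_V1.
rewrite [X in _ + _ + X + _]big_pred0 // !addr0.
by rewrite (big_pred1 (i, j)) // => -[k l].
Qed.

(** Besides [Aij i j], only the [A1] arc of the preceding column leaves; the sum over [l] holds this
    one term, or none in column 0. *)
Lemma outflow_V1 i j :
  \sum_(a : darc D | dtail a == V1 i j) z a =
    z (Aij i j) + \sum_(l < n | l.+1 == j) z (A1 i l).
Proof.
rewrite big_pm_arc /= [X in _ + X + _ + _]big_pred0 // !addr0 addrC.
congr (_ + _); first by rewrite (big_pred1 (i, j)) // => -[k l].
rewrite -(big_pair_row (fun k l => z (A1 k l)) i (fun l => l.+1 == j)).
by apply: eq_bigl => s; exact: pm_tail_A1_V1.
Qed.

Lemma inflow_V2 i j :
  \sum_(a : darc D | dhead a == V2 i j) z a =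
    z (Aij i j) + \sum_(k < m | k.+1 == i) z (A2 k j).
Proof.
rewrite big_pm_arc /= [X in X + _ + _ + _]big_pred0 // !addr0 add0r addrC.
congr (_ + _); first by rewrite (big_pred1 (i, j)) // => -[k l].
rewrite -(big_pair_col (fun k l => z (A2 k l)) (fun k => k.+1 == i) j).
by apply: eq_bigl => s; exact: pm_head_A2_V2.
Qed.

Lemma outflow_V2 i j : \sum_(a : darc D | dtail a == V2 i j) z a = z (A2 i j).
Proof.
rewrite big_pm_arc /= [X in X + _ + _ + _]big_pred0; last first.
  by move=> s; exact: pm_tail_A1_V2.
rewrite [X in _ + _ + X + _]big_pred0 // !addr0 add0r.
by rewrite (big_pred1 (i, j)) // => -[k l].
Qed.

Lemma inflow_V10 : \sum_(a : darc D | dhead a == V10) z a = z A0.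
Proof.
rewrite big_pm_arc /= !big_pred0 ?add0r // => s.
exact: pm_head_A2_V10.
Qed.

Lemma outflow_V10 :
  \sum_(a : darc D | dtail a == V10) z a = \sum_i \sum_(j < n | j.+1 == n) z (A1 i j).
Proof.
rewrite big_pm_arc /= [X in _ + X + _ + _]big_pred0 //.
rewrite [X in _ + _ + X + _]big_pred0 // !addr0 pair_big.
by apply: eq_bigl => s; exact: pm_tail_A1_V10.
Qed.

Lemma inflow_V20 :
  \sum_(a : darc D | dhead a == V20) z a = \sum_j \sum_(i < m | i.+1 == m) z (A2 i j).
Proof.
rewrite big_pm_arc /= [X in X + _ + _ + _]big_pred0 //.
(* Arc indices have the row first, so the double sum is reordered before it is merged into a sum
   over pairs. *)
rewrite [X in _ + _ + X + _]big_pred0 // !addr0 add0r exchange_big pair_big.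
by apply: eq_bigl => s; rewrite /= andbT; exact: pm_head_A2_V20.
Qed.

Lemma outflow_V20 : \sum_(a : darc D | dtail a == V20) z a = z A0.
Proof.
rewrite big_pm_arc /= !big_pred0 ?add0r // => s.
exact: pm_tail_A1_V20.
Qed.

End Balance.

(** * Correspondence between circulations and matrices *)

(** At [V1] and [V2] the balance is the prefix recurrence; at [V10] and [V20] it sums all entries by
    rows and by columns respectively. *)
Lemma circ_of_matrix_circulation (R : realType) (m n : nat) (M : 'M[R]_(m, n)) :
  circulation (circ_of_matrix M).
Proof.
case=> [i j|i j||].
- by rewrite inflow_V1 outflow_V1 /= prefix_sum_rec.
- by rewrite inflow_V2 outflow_V2 /= (prefix_sum_rec (M^~ j)).
- rewrite inflow_V10 outflow_V10 /= -(pair_bigA _ (fun i j => M i j)) /=.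
  by apply: eq_bigr => i _; rewrite prefix_sum_last.
- rewrite inflow_V20 outflow_V20 /= -(pair_bigA _ (fun i j => M i j)) /=.
  rewrite [RHS]exchange_big; apply: eq_bigr => j _.
  by rewrite (prefix_sum_last (M^~ j)).
Qed.

Lemma circulation_circ_of_matrix (R : realType) (m n : nat)
    (z : darc (pm_digraph m n) -> R) :
  circulation z -> z =1 circ_of_matrix (matrix_of_circ z).
Proof.
move=> z_circ.
have zA1 i j : z (A1 i j) = circ_of_matrix (matrix_of_circ z) (A1 i j).
  (* Conservation at [V1 i l] is the recurrence along row [i]. *)
  apply: (prefix_sum_unique (G := fun l => z (A1 i l))) => l.
  by rewrite mxE -inflow_V1 z_circ outflow_V1.
case=> [i j|i j|i j|]; first exact: zA1.
- apply: (prefix_sum_unique (F := fun k => matrix_of_circ z k j)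
    (G := fun k => z (A2 k j))) => k.
  by rewrite mxE -outflow_V2 -z_circ inflow_V2.
- by rewrite /= mxE.
(* Both functions are circulations, so at [V10] their values on [A0] are determined by the [A1]
   arcs, where they already agree. *)
- rewrite -inflow_V10 z_circ outflow_V10 -[RHS]inflow_V10.
  rewrite circ_of_matrix_circulation outflow_V10.
  by apply: eq_bigr => i _; apply: eq_bigr => j _; exact: zA1.
Qed.

(** * Sums over prefix sets as arc values *)

Section SetSums.
Variables (R : realType) (m n : nat) (M : 'M[R]_(m, n)).

Lemma set_sum_row_prefix i j :
  set_sum M (row_prefix i j) = circ_of_matrix M (A1 i j).
Proof.
rewrite /set_sum /= -(big_pair_row (fun k l => M k l) i (fun l => (l <= j)%N)).
by apply: eq_bigl => s; rewrite inE.
Qed.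

Lemma set_sum_col_prefix i j :
  set_sum M (col_prefix i j) = circ_of_matrix M (A2 i j).
Proof.
rewrite /set_sum /= -(big_pair_col (fun k l => M k l) (fun k => (k <= i)%N) j).
by apply: eq_bigl => s; rewrite inE.
Qed.

Lemma set_sum_setT : set_sum M [set: 'I_m * 'I_n] = circ_of_matrix M A0.
Proof. by apply: eq_bigl => s; rewrite inE. Qed.

End SetSums.

(** * Translation of the bounds in both directions *)

Theorem theorem7p2 (R : realType) (m n : nat)
    (Phi1 Gamma1 Phi2 Gamma2 f g : 'M[\bar R]_(m, n)) (alpha beta : \bar R)
    (m_gt0 : (0 < m)%N) (n_gt0 : (0 < n)%N)
    (Phi1_lb : lower_bound_matrix Phi1) (Gamma1_ub : upper_bound_matrix Gamma1)
    (Phi2_lb : lower_bound_matrix Phi2) (Gamma2_ub : upper_bound_matrix Gamma2)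
    (f_lb : lower_bound_matrix f) (g_ub : upper_bound_matrix g)
    (alpha_int : ext_integer alpha) (beta_int : ext_integer beta)
    (le1 : le_matrix Phi1 Gamma1) (le2 : le_matrix Phi2 Gamma2)
    (le_fg : le_matrix f g) (le_ab : (alpha <= beta)%E) :
  (forall z : darc (pm_digraph m n) -> R,
     circulation z -> integer_valued z ->
     (forall a, (arc_bound Phi1 Phi2 f alpha a <= (z a)%:E
                 <= arc_bound Gamma1 Gamma2 g beta a)%E) ->
     prefix_bounded Phi1 Gamma1 Phi2 Gamma2 (matrix_of_circ z) /\
     entries_between f g (matrix_of_circ z) /\
     (alpha <= (set_sum (matrix_of_circ z) [set: 'I_m * 'I_n])%:E <= beta)%E) /\
  (forall M : 'M[R]_(m, n),
     prefix_bounded Phi1 Gamma1 Phi2 Gamma2 M ->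
     entries_between f g M ->
     (alpha <= (set_sum M [set: 'I_m * 'I_n])%:E <= beta)%E ->
     circulation (circ_of_matrix M) /\
     integer_valued (circ_of_matrix M) /\
     (forall a, (arc_bound Phi1 Phi2 f alpha a <= (circ_of_matrix M a)%:E
                 <= arc_bound Gamma1 Gamma2 g beta a)%E)).
Proof.
split=> [z z_circ z_int z_bnd|M [M_int M_pre] M_ent M_sum].
  have zE := circulation_circ_of_matrix z_circ.
  split; last split.
  - split=> [i j|i j]; first by rewrite mxE.
    (* Prefix sums of the matrix of [z] become values of [z] itself, so the arc bounds apply
       directly. *)
    rewrite set_sum_row_prefix set_sum_col_prefix -!zE.
    by split; [exact: (z_bnd (A1 i j)) | exact: (z_bnd (A2 i j))].
  - by move=> i j; rewrite mxE; exact: (z_bnd (Aij i j)).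
  - by rewrite set_sum_setT -zE; exact: (z_bnd A0).
split; first exact: circ_of_matrix_circulation.
split=> [[i j|i j|i j|]|[i j|i j|i j|]].
- by apply: rpred_sum => k _.
- by apply: rpred_sum => k _.
- exact: M_int.
- by apply: rpred_sum => s _.
- by rewrite -set_sum_row_prefix; case: (M_pre i j).
- by rewrite -set_sum_col_prefix; case: (M_pre i j).
- exact: M_ent.
- by rewrite -set_sum_setT.
Qed.
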